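(* Let $f:\mathbb{R}^n\to\mathbb{R}$ be $L$-smooth and $\mu$-strongly convex with $\mu>0$, let $\mathcal{P}\subseteq\mathbb{R}^{n\times n}$ be a closed convex set (not necessarily bounded), let $P_r^\star$ be a universal optimal preconditioner in $\mathcal{P}_+=\mathcal{P}\cap\mathbb{S}^n_+$ and $\kappa^\star$ the corresponding optimal condition number. Let $K\ge1$, $x^1\in\mathbb{R}^n$, $P_1\in\mathcal{P}$, and let $\{x^k\}$ be generated by OSGM-R with stepsize $\eta=\min\big\{\tfrac1{4L^2},\tfrac{\|P_r^\star-P_1\|_F}{2L\sqrt K}\big\}$. Assume $x^1,\dots,x^K$ are not minimizers of $f$. Then $$f(x^{K+1})-f(x^\star)\le(f(x^1)-f(x^\star))\Big(1-\frac1{\kappa^\star}+\max\Big\{\frac{4L\|P_r^\star-P_1\|_F}{\sqrt K},\frac{8L^2\|P_r^\star-P_1\|_F^2}{K}\Big\}\Big)^K.$$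
   Context: $\|\cdot\|$ is the Euclidean norm of vectors; $\|\cdot\|_F$ is the Frobenius norm of matrices. Assumptions on $f$: $f$ is twice differentiable; $L$-smooth means $|f(x)-f(y)-\langle\nabla f(y),x-y\rangle|\le\frac L2\|x-y\|^2$ for all $x,y$; $\mu$-strongly convex means $f(x)-f(y)-\langle\nabla f(y),x-y\rangle\ge\frac\mu2\|x-y\|^2$ for all $x,y$. $x^\star$ is the minimizer of $f$. Universal optimal preconditioner: $P_r^\star$ is an optimal solution, and $\kappa^\star$ the optimal value, of the problem of minimizing $\kappa>0$ over $P\in\mathcal{P}_+$ subject to $\frac1\kappa I\preceq P^{1/2}\nabla^2f(x)P^{1/2}\preceq I$ for all $x\in\mathbb{R}^n$. Ratio surrogate: for $x$ not a minimizer and $P\in\mathbb{R}^{n\times n}$, $r_x(P):=\dfrac{f(x-P\nabla f(x))-f(x^\star)}{f(x)-f(x^\star)}$, with gradient $\nabla r_x(P)=-\dfrac{\nabla f(x-P\nabla f(x))\nabla f(x)^\top}{f(x)-f(x^\star)}$. OSGM-R: for $k=1,2,\dots$: $x^{k+1}=x^k-P_k\nabla f(x^k)$ and $P_{k+1}=\Pi_{\mathcal{P}}[P_k-\eta\nabla r_{x^k}(P_k)]$, where $\Pi_{\mathcal{P}}$ is the orthogonal projection onto $\mathcal{P}$ (Frobenius inner product). *)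

(* Defs.v *)
From HB Require Import structures.
From mathcomp Require Import all_boot all_order all_algebra.
From mathcomp Require Import all_classical all_reals all_analysis.

Set Implicit Arguments.
Unset Strict Implicit.
Unset Printing Implicit Defensive.

Import Order.TTheory GRing.Theory Num.Theory.
Import numFieldNormedType.Exports.

Local Open Scope classical_set_scope.
Local Open Scope ring_scope.

(* The library norm `|A| on matrices is the sup norm, hence the following.    *)
(* For columns they are the dot product and the Euclidean norm; in general    *)
(* they are the Frobenius inner product and norm.                             *)
Definition inner (R : realType) (m n : nat) (A B : 'M[R]_(m, n)) : R :=
  \tr (A^T *m B).

Definition fnorm (R : realType) (m n : nat) (A : 'M[R]_(m, n)) : R :=
  Num.sqrt (inner A A).

(* Gradient for the Frobenius inner product, as the array of the partial      *)
(* derivatives along the matrix units; the case of columns is n = 1.          *)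
Definition grad (R : realType) (m n : nat) (g : 'M[R]_(m, n) -> R)
    (A : 'M[R]_(m, n)) : 'M[R]_(m, n) :=
  \matrix_(i, j) 'D_(delta_mx i j) g A.

Definition hessian (R : realType) (n : nat) (f : 'cV[R]_n -> R)
    (x : 'cV[R]_n) : 'M[R]_n :=
  \matrix_(i, j) 'D_(delta_mx j 0) (fun y => grad f y i 0) x.

(* Frechet differentiability does not depend on the norm chosen on R^n. *)
Definition twice_differentiable (R : realType) (n : nat)
    (f : 'cV[R]_n -> R) : Prop :=
  (forall x, differentiable f x) /\ (forall x, differentiable (grad f) x).

Definition smooth (R : realType) (n : nat) (L : R) (f : 'cV[R]_n -> R) : Prop :=
  forall x y, `|f x - f y - inner (grad f y) (x - y)| <=
    L / 2 * fnorm (x - y) ^+ 2.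

Definition strongly_convex (R : realType) (n : nat) (mu : R)
    (f : 'cV[R]_n -> R) : Prop :=
  forall x y, f x - f y - inner (grad f y) (x - y) >=
    mu / 2 * fnorm (x - y) ^+ 2.

Definition minimizer (R : realType) (n : nat) (f : 'cV[R]_n -> R)
    (x : 'cV[R]_n) : Prop :=
  forall y, f x <= f y.

Definition psd (R : realType) (n : nat) (A : 'M[R]_n) : Prop :=
  A^T = A /\ forall v : 'cV[R]_n, 0 <= inner v (A *m v).

Definition loewner (R : realType) (n : nat) (A B : 'M[R]_n) : Prop :=
  psd (B - A).

(* S = P^{1/2}, the unique positive semidefinite square root of P. *)
Definition is_psd_sqrt (R : realType) (n : nat) (P S : 'M[R]_n) : Prop :=
  psd S /\ S *m S = P.

Definition precond_feasible (R : realType) (n : nat) (f : 'cV[R]_n -> R)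
    (Pset : set 'M[R]_n) (P : 'M[R]_n) (kappa : R) : Prop :=
  [/\ 0 < kappa, Pset P, psd P &
      exists2 S, is_psd_sqrt P S &
        forall x, loewner (kappa^-1)%:M (S *m hessian f x *m S) /\
                  loewner (S *m hessian f x *m S) 1%:M].

Definition universal_optimal_precond (R : realType) (n : nat)
    (f : 'cV[R]_n -> R) (Pset : set 'M[R]_n) (P : 'M[R]_n) (kappa : R) : Prop :=
  precond_feasible f Pset P kappa /\
  forall P' kappa', precond_feasible f Pset P' kappa' -> kappa <= kappa'.

Definition ratio_surrogate (R : realType) (n : nat) (f : 'cV[R]_n -> R)
    (xstar x : 'cV[R]_n) (P : 'M[R]_n) : R :=
  (f (x - P *m grad f x) - f xstar) / (f x - f xstar).

Definition is_projection (R : realType) (n : nat) (Pset : set 'M[R]_n)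
    (A Q : 'M[R]_n) : Prop :=
  Pset Q /\ forall Q', Pset Q' -> fnorm (Q - A) <= fnorm (Q' - A).

(* The first K steps of OSGM-R. Indices start at 1: x 0 and P 0 are unused.   *)
(* Steps after K are left free, as the surrogate is undefined at a minimizer. *)
Definition osgm_r (R : realType) (n : nat) (f : 'cV[R]_n -> R)
    (xstar : 'cV[R]_n) (Pset : set 'M[R]_n) (eta : R) (K : nat)
    (x : nat -> 'cV[R]_n) (P : nat -> 'M[R]_n) : Prop :=
  forall k : nat, (1 <= k <= K)%N ->
    x k.+1 = x k - P k *m grad f (x k) /\
    is_projection Pset
      (P k - eta *: grad (ratio_surrogate f xstar (x k)) (P k)) (P k.+1).

(* Main.v *)
(** The surrogate [r_x] is convex in [P], and its gradient satisfies
    [|grad r_x (P)|^2 <= 4 L^2 r_x(P)] because [|grad f|^2 <= 2 L (f - f xstar)].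
    Projected online gradient descent therefore has regret
    [(2 eta - 4 L^2 eta^2) sum_k r(P_k) <= |P_1 - Pstar|^2 + 2 eta sum_k r(Pstar)].
    Since [S H S <= I] and [S H S >= I / kappa] for [S = Pstar^{1/2}], one
    gradient step preconditioned by [Pstar] contracts the gap by
    [1 - 1 / kappa], so [r(Pstar) <= 1 - 1 / kappa]. The gap after [K] steps is
    the initial gap times the product of the ratios [r(P_k)], which by AM-GM is
    at most the [K]-th power of their mean. *)

Require Import Defs.
From HB Require Import structures.
From mathcomp Require Import all_boot all_order all_algebra.
From mathcomp Require Import all_classical all_reals all_analysis.
From mathcomp Require Import ring lra.

Set Implicit Arguments.
Unset Strict Implicit.
Unset Printing Implicit Defensive.

Import Order.TTheory GRing.Theory Num.Theory.
Import numFieldNormedType.Exports.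

Local Open Scope classical_set_scope.
Local Open Scope ring_scope.

(** * Frobenius inner product *)

Section FrobeniusInner.
Variables (R : realType) (m n : nat).
Implicit Types A B C : 'M[R]_(m, n).

Lemma innerE A B : inner A B = \sum_i \sum_j A i j * B i j.
Proof.
rewrite exchange_big /inner /mxtrace; apply: eq_bigr => j _.
by rewrite mxE; apply: eq_bigr => i _; rewrite mxE.
Qed.

Lemma innerC A B : inner A B = inner B A.
Proof. by rewrite !innerE; do 2!apply: eq_bigr => ? _; rewrite mulrC. Qed.

Lemma innerDr A B C : inner A (B + C) = inner A B + inner A C.
Proof. by rewrite /inner mulmxDr mxtraceD. Qed.

Lemma innerZr a A B : inner A (a *: B) = a * inner A B.
Proof. by rewrite /inner -scalemxAr mxtraceZ. Qed.

Lemma innerNr A B : inner A (- B) = - inner A B.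
Proof. by rewrite -scaleN1r innerZr mulN1r. Qed.

Lemma innerDl A B C : inner (B + C) A = inner B A + inner C A.
Proof. by rewrite innerC innerDr !(innerC A). Qed.

Lemma innerZl a A B : inner (a *: B) A = a * inner B A.
Proof. by rewrite innerC innerZr (innerC A). Qed.

Lemma innerNl A B : inner (- B) A = - inner B A.
Proof. by rewrite innerC innerNr (innerC A). Qed.

Lemma inner_ge0 A : 0 <= inner A A.
Proof. by rewrite innerE; do 2!apply: sumr_ge0 => ? _; rewrite -expr2 sqr_ge0. Qed.

Lemma inner_eq0 A : (inner A A == 0) = (A == 0).
Proof.
apply/eqP/eqP => [|->]; last by rewrite -(scale0r 0) innerZl mul0r.
rewrite innerE => /eqP; rewrite psumr_eq0 => [/allP A0|i _]; last first.
  by apply: sumr_ge0 => j _; rewrite -expr2 sqr_ge0.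
apply/matrixP => i j; move/(_ i): A0; rewrite mem_index_enum => /(_ isT).
rewrite psumr_eq0 => [/allP/(_ j)|k _]; last by rewrite -expr2 sqr_ge0.
by rewrite mem_index_enum => /(_ isT); rewrite /= -expr2 sqrf_eq0 mxE => /eqP.
Qed.

Lemma fnorm_sqr A : fnorm A ^+ 2 = inner A A.
Proof. by rewrite sqr_sqrtr // inner_ge0. Qed.

Lemma fnorm_ge0 A : 0 <= fnorm A.
Proof. exact: sqrtr_ge0. Qed.

Lemma ler_fnorm A B : (fnorm A <= fnorm B) = (inner A A <= inner B B).
Proof. by rewrite ler_psqrt // nnegrE inner_ge0. Qed.

End FrobeniusInner.

Lemma inner_mulmxl (R : realType) m n p (A : 'M[R]_(m, n)) (B : 'M[R]_(n, p))
  (C : 'M[R]_(m, p)) : inner (A *m B) C = inner B (A^T *m C).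
Proof. by rewrite /inner trmx_mul mulmxA. Qed.

Lemma inner_outer (R : realType) m n (u : 'cV[R]_m) (v : 'cV_n) (A : 'M[R]_(m, n)) :
  inner (u *m v^T) A = inner u (A *m v).
Proof. by rewrite /inner trmx_mul trmxK -mulmxA mxtrace_mulC mulmxA. Qed.

Lemma inner_outer_outer (R : realType) m n (u : 'cV[R]_m) (v : 'cV_n) :
  inner (u *m v^T) (u *m v^T) = inner u u * inner v v.
Proof.
rewrite inner_outer -mulmxA.
have -> : v^T *m v = (inner v v)%:M by rewrite [LHS]mx11_scalar /inner trace_mx11.
by rewrite mul_mx_scalar innerZr mulrC.
Qed.

(** * Derivatives along lines and second-order bounds *)

Section LineDerivatives.
Variables (R : realType) (n : nat).
Implicit Types (f : 'cV[R]_n -> R) (y u : 'cV[R]_n).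

Lemma derive_gradE f y u :
  differentiable f y -> 'D_u f y = inner (grad f y) u.
Proof.
move=> df; rewrite deriveE // {1}(matrix_sum_delta u) innerE raddf_sum /=.
by apply: eq_bigr => i _; rewrite !big_ord1 linearZ /= -deriveE // mxE mulrC.
Qed.

Lemma is_derive_line f y u (t : R) :
  differentiable f (y + t *: u) ->
  is_derive t 1 (fun s : R => f (y + s *: u)) (inner (grad f (y + t *: u)) u).
Proof.
move=> df; rewrite -derive_gradE //.
have E : (fun h : R => h^-1 *: (((fun s => f (y + s *: u)) \o shift t) (h *: 1)
    - f (y + t *: u))) =
  (fun h => h^-1 *: ((f \o shift (y + t *: u)) (h *: u) - f (y + t *: u))).
  apply/funext => h /=; congr (_ *: (f _ - _)).
  by rewrite [h%:A]mulr1 scalerDl addrCA.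
have := diff_derivable (v := u) df.
by split; rewrite /derivable /derive E.
Qed.

(** Each coordinate of [grad f] is a scalar function to which [is_derive_line] applies, and its
    gradient is the corresponding row of the Hessian. *)
Lemma is_derive_grad_line f y u (t : R) :
  differentiable (grad f) (y + t *: u) ->
  is_derive t 1 (fun s : R => inner (grad f (y + s *: u)) u)
    (inner u (hessian f (y + t *: u) *m u)).
Proof.
move=> df.
pose h i := fun x => grad f x i 0.
have dh i : differentiable (h i) (y + t *: u).
  exact: (differentiable_comp df (differentiable_coord _ _ _)).
have dline i := is_derive_line (dh i).
have -> : (fun s : R => inner (grad f (y + s *: u)) u) =
    \sum_(i < n) (u i 0 \*: (fun s => h i (y + s *: u))).
  apply/funext => s; rewrite innerE fct_sumE; apply: eq_bigr => i _.
  by rewrite big_ord1 mulrC.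
apply: is_derive_eq.
rewrite innerE; apply: eq_bigr => i _; rewrite big_ord1 /GRing.scale /=.
congr (_ * _); rewrite innerE mxE; apply: eq_bigr => j _.
by rewrite big_ord1 !mxE.
Qed.

End LineDerivatives.

(** The mean value theorem is applied twice, in place of an integral remainder, since [p2] is not
    assumed continuous. *)
Lemma taylor2_ge (R : realType) (p p1 p2 : R -> R) (a : R) :
  (forall t : R, is_derive t 1 p (p1 t)) ->
  (forall t : R, is_derive t 1 p1 (p2 t)) ->
  (forall t, a <= p2 t) -> a / 2 <= p 1 - p 0 - p1 0.
Proof.
move=> dp dp1 ap2.
(* With the quadratic model subtracted, [q 1 - q 0] is the difference to be bounded; it equals the
   derivative of [q] at some [c], that is [(p2 d - a) * c]. *)
pose q s := p s - p1 0 * s - a / 2 * s ^+ 2.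
have dq (t : R) : is_derive t 1 q (p1 t - p1 0 - a * t).
  rewrite /q; apply: is_derive_eq.
  by rewrite /GRing.scale /=; field.
have cont (g dg : R -> R) (b c : R) : (forall t : R, is_derive t 1 g (dg t)) ->
    {within `[b, c], continuous g}.
  by move=> d; apply: derivable_within_continuous => t _; apply: ex_derive.
have [c] := MVT_segment (ler01) (fun t _ => dq t) (cont _ _ _ _ dq).
rewrite in_itv /= => /andP[c0 _].
have [d _ dE] := MVT_segment c0 (fun t _ => dp1 t) (cont _ _ _ _ dp1).
rewrite dE /q => qE.
have : 0 <= (p2 d - a) * c by rewrite mulr_ge0 // subr_ge0.
by lra.
Qed.

Section SecondOrder.
Variables (R : realType) (n : nat) (f : 'cV[R]_n -> R).
Hypothesis f2 : twice_differentiable f.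

(** Only the curvature along the one direction [u] is bounded, and [a] absorbs the length of [u], so
    that any metric can measure that length, in particular a preconditioned one. *)
Lemma hessian_lower_bound (a : R) u y :
  (forall x, a <= inner u (hessian f x *m u)) ->
  a / 2 <= f (y + u) - f y - inner (grad f y) u.
Proof.
move=> ha; case: f2 => df dg.
have := taylor2_ge (fun t => is_derive_line (df (y + t *: u)))
  (fun t => is_derive_grad_line (dg (y + t *: u))) (fun t => ha _).
by rewrite scale1r scale0r addr0.
Qed.

Lemma hessian_upper_bound (b : R) u y :
  (forall x, inner u (hessian f x *m u) <= b) ->
  f (y + u) - f y - inner (grad f y) u <= b / 2.
Proof.
move=> hb; case: f2 => df dg.
have := taylor2_ge (a := - b)
  (fun t => is_deriveN (is_derive_line (df (y + t *: u))))
  (fun t => is_deriveN (is_derive_grad_line (dg (y + t *: u)))).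
rewrite !fctE scale1r scale0r addr0 => /(_ (fun t => _)) H.
suff : - b / 2 <= - f (y + u) - - f y - - inner (grad f y) u by lra.
by apply: H => t; rewrite lerN2.
Qed.

End SecondOrder.

(** * Projection onto a convex set *)

Lemma linear_coef_ge0 (R : realFieldType) (b e : R) : 0 <= e ->
  (forall t, 0 <= t -> t <= 1 -> 0 <= 2 * t * b + t ^+ 2 * e) -> 0 <= b.
Proof.
move=> e0 bound; rewrite leNgt; apply/negP => bn.
(* If [b < 0], the point [t = - b / (e - b)] makes the linear term win. The denominator [e - b]
   keeps [t] within the unit interval even when [e = 0]. *)
have eb0 : 0 < e - b by lra.
have t0 : 0 <= - b / (e - b) by apply: divr_ge0; lra.
have t1 : - b / (e - b) <= 1 by rewrite ler_pdivrMr //; lra.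
have := bound _ t0 t1.
have -> : 2 * (- b / (e - b)) * b + (- b / (e - b)) ^+ 2 * e =
  (b / (e - b)) ^+ 2 * (2 * b - e) by field; rewrite gt_eqF.
have : 0 < (b / (e - b)) ^+ 2.
  by rewrite exprn_even_gt0 //= mulf_neq0 ?invr_eq0 ?(gt_eqF eb0) ?(lt_eqF bn).
by nra.
Qed.

Lemma inner_delta (R : realType) m n (A : 'M[R]_(m, n)) i j :
  inner A (delta_mx i j) = A i j.
Proof.
rewrite innerE (bigD1 i) //= (bigD1 j) //= mxE !eqxx mulr1.
rewrite !big1 ?addr0 // => [k ki|k kj]; last by rewrite mxE (negPf kj) andbF mulr0.
by apply: big1 => l _; rewrite mxE (negPf ki) mulr0.
Qed.

(** Minimality of [Q] along the segment from [Q] to [B] gives the variational inequality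
    [0 <= inner (Q - A) (B - Q)], which is the cross term when the square of [A - B] is expanded
    around [Q]. *)
Lemma projection_contracts (R : realType) n (C : set 'M[R]_n) A Q B :
  convex_set C -> is_projection C A Q -> C B ->
  inner (Q - B) (Q - B) <= inner (A - B) (A - B).
Proof.
move=> cC [CQ Qmin] CB.
set b := inner (Q - A) (B - Q); set e := inner (B - Q) (B - Q).
have e0 : 0 <= e := inner_ge0 _.
have segment t : 0 <= t -> t <= 1 -> 0 <= 2 * t * b + t ^+ 2 * e.
  move=> t0 t1.
  have /set_mem := cC B Q (Itv01 t0 t1) (mem_set CB) (mem_set CQ).
  move=> /Qmin; rewrite ler_fnorm /=.
  have -> : conv (Itv01 t0 t1) (B : convex_lmodType 'M[R]_n) Q - A =
      (Q - A) + t *: (B - Q).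
    by apply/matrixP => i j; rewrite !mxE /= /unstable.onem; ring.
  rewrite /b /e; move: (Q - A) (B - Q) => X Y.
  by rewrite innerDl !innerDr !innerZl !innerZr (innerC Y); lra.
have b_ge0 : 0 <= b := linear_coef_ge0 e0 segment.
have -> : A - B = - (Q - A) - (B - Q) by rewrite !opprB subrKA.
have -> : Q - B = - (B - Q) by rewrite opprB.
move: b_ge0 e0; rewrite /b /e; move: (Q - A) (B - Q) => X Y b_ge0 e0.
rewrite innerDl !innerDr !innerNl !innerNr (innerC Y).
by have := inner_ge0 X; lra.
Qed.

(** * Gradient, convexity and self-bounding of the ratio surrogate *)

(** A gradient step of length [L^-1] lowers [f] by at least the squared gradient norm over [2 * L],
    and cannot go below [f xstar]. *)
Lemma smooth_grad_bound (R : realType) n (f : 'cV[R]_n -> R) L xstar x :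
  0 < L -> smooth L f -> minimizer f xstar ->
  inner (grad f x) (grad f x) <= 2 * L * (f x - f xstar).
Proof.
move=> L0 fL fmin; set g := grad f x.
have := fL (x - L^-1 *: g) x; have := fmin (x - L^-1 *: g).
rewrite ler_norml fnorm_sqr addrAC subrr add0r.
rewrite !innerNr innerNl !innerZr innerZl -/g !opprK => fx /andP[_].
move: (inner g g) => a in fx *.
have -> : L / 2 * (L^-1 * (L^-1 * a)) = L^-1 * a / 2.
  by field; rewrite gt_eqF.
move=> H; have : L^-1 * a <= 2 * (f x - f xstar) by lra.
by rewrite mulrC ler_pdivrMr // mulrAC.
Qed.

Section RatioSurrogate.
Variables (R : realType) (n : nat) (f : 'cV[R]_n -> R) (xstar x : 'cV[R]_n).
Hypothesis df : forall z, differentiable f z.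
Local Notation r := (ratio_surrogate f xstar x).

Lemma grad_ratio_surrogate P :
  grad r P = - (f x - f xstar)^-1 *:
    (grad f (x - P *m grad f x) *m (grad f x)^T).
Proof.
apply/matrixP => i j; rewrite mxE [RHS]mxE.
set g := grad f x; set c := f x - f xstar; set y := x - P *m g.
(* Moving [P] by [h] along a matrix unit moves the new point [y] by [h *: u], so each partial
   derivative is a line derivative of [f]. *)
pose u := - (delta_mx i j *m g).
have dl := is_derive_line (t := 0) (df (y + 0 *: u)).
have -> : 'D_(delta_mx i j) r P =
    'D_1 (c^-1 \*: ((fun s : R => f (y + s *: u)) - cst (f xstar))) (0 : R).
  rewrite /derive; set q := (fun _ => _); set q' := (fun _ => _).
  suff -> : q = q' by []; apply/funext => h; rewrite {}/q {}/q' /=; congr (_ *: _).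
  transitivity (c^-1 * (f (y + h *: u) - f xstar) - c^-1 * (f y - f xstar)).
    rewrite /ratio_surrogate -/c -/g ![c^-1 * _]mulrC.
    congr ((f _ - _) / _ - _).
    by rewrite mulmxDl -scalemxAl scalerN opprD addrCA addrC.
  by rewrite !fctE addr0 [h%:A]mulr1 scale0r addr0.
rewrite derive_val subr0 scale0r addr0 innerNr scalerN [_ *: _]mulrC.
by rewrite -inner_outer inner_delta mulrC mulNr.
Qed.

(** The surrogate is a positive multiple of [f] composed with a map affine in the preconditioner, up
    to a constant; the quadratic term of strong convexity is dropped. *)
Lemma ratio_surrogate_convex mu P Q :
  0 < mu -> strongly_convex mu f -> f xstar < f x ->
  r P + inner (grad r P) (Q - P) <= r Q.
Proof.
move=> mu0 fmu fx; rewrite grad_ratio_surrogate innerZl inner_outer.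
rewrite mulNr mulrC /ratio_surrogate -mulrBl ler_pM2r ?invr_gt0 ?subr_gt0 //.
set g := grad f x.
have := fmu (x - Q *m g) (x - P *m g).
have -> : x - Q *m g - (x - P *m g) = - ((Q - P) *m g).
  by rewrite mulmxBl !opprB addrC subrKA.
rewrite innerNr => H.
have : 0 <= mu / 2 * fnorm (- ((Q - P) *m g)) ^+ 2.
  by rewrite mulr_ge0 ?sqr_ge0 // divr_ge0 // ltW.
by lra.
Qed.

(** The gradient has rank one, so its squared norm is a product of two squared gradient norms of
    [f], at the old and at the new point. Bounding both by gaps cancels one power of the old gap and
    leaves the ratio. *)
Lemma ratio_surrogate_grad_bound L P :
  0 < L -> smooth L f -> minimizer f xstar -> f xstar < f x ->
  inner (grad r P) (grad r P) <= 4 * L ^+ 2 * r P.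
Proof.
move=> L0 fL fmin fx; rewrite grad_ratio_surrogate innerZl innerZr.
rewrite inner_outer_outer /ratio_surrogate.
have c0 : 0 < f x - f xstar by rewrite subr_gt0.
have := smooth_grad_bound (x - P *m grad f x) L0 fL fmin.
have := smooth_grad_bound x L0 fL fmin.
set g := grad f x; set G := grad f _; set c := f x - _ in c0 *.
set d := f _ - _ => hg hG.
have -> : 4 * L ^+ 2 * (d / c) = c^-1 * (c^-1 * ((2 * L * d) * (2 * L * c))).
  by field; rewrite gt_eqF.
rewrite !mulNr mulrN opprK !ler_pM2l ?invr_gt0 //.
by apply: ler_pM; rewrite // inner_ge0.
Qed.

End RatioSurrogate.

(** * Contraction by a feasible preconditioner *)

(** For displacements written [S *m v], the curvature in [v] lies between [kappa^-1] and 1. The step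
    is then a unit gradient step in [v], and the contraction follows from a descent bound and a
    Polyak-Lojasiewicz bound. *)
Lemma preconditioned_step (R : realType) n (f : 'cV[R]_n -> R) C P kappa xstar x :
  twice_differentiable f -> precond_feasible f C P kappa ->
  f (x - P *m grad f x) - f xstar <= (1 - kappa^-1) * (f x - f xstar).
Proof.
move=> f2 [k0 _ _ [S [[St _] <-] HS]]; set g := grad f x.
have SHS z (v : 'cV_n) : inner (S *m v) (hessian f z *m (S *m v)) =
    inner v (S *m hessian f z *m S *m v) by rewrite inner_mulmxl St !mulmxA.
have lo z (v : 'cV_n) : kappa^-1 * inner v v <= inner (S *m v) (hessian f z *m (S *m v)).
  have [[_ /(_ v) Hv] _] := HS z; move: Hv.
  by rewrite mulmxBl innerDr innerNr mul_scalar_mx innerZr SHS subr_ge0.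
have up z (v : 'cV_n) : inner (S *m v) (hessian f z *m (S *m v)) <= inner v v.
  have [_ [_ /(_ v) Hv]] := HS z; move: Hv.
  by rewrite mulmxBl innerDr innerNr mul1mx SHS subr_ge0.
(* A kernel vector of [S] has zero curvature, so the lower bound forces it to vanish. *)
have Sunit : S \in unitmx.
  rewrite -row_free_unit; apply: inj_row_free => v vS.
  have Sv : S *m v^T = 0 by rewrite -St -trmx_mul vS trmx0.
  apply: trmx_inj; rewrite trmx0; apply/eqP; rewrite -inner_eq0.
  apply/eqP/le_anti; rewrite inner_ge0 andbT.
  have := lo 0 v^T; rewrite Sv mulmx0 /inner mulmx0 linear0.
  by rewrite pmulr_rle0 // invr_gt0.
have gS (v : 'cV_n) : inner g (S *m v) = inner (S *m g) v by rewrite inner_mulmxl St.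
have decrease : f (x - S *m S *m g) <= f x - inner (S *m g) (S *m g) / 2.
  have := hessian_upper_bound f2 x (fun z => up z (- (S *m g))).
  by rewrite -/g gS mulmxN !innerNr innerNl opprK mulmxA; lra.
have gap : f x - f xstar <= kappa / 2 * inner (S *m g) (S *m g).
  (* [w] is the displacement to [xstar] in the coordinates of [S]. The square of
     [kappa *: (S *m g) + w] completes the square in the lower model of [f]. *)
  pose w := invmx S *m (xstar - x).
  have := hessian_lower_bound f2 x (fun z => lo z w).
  rewrite -/g gS mulKVmx // subrKC => H.
  have := inner_ge0 (kappa *: (S *m g) + w).
  rewrite innerDl !innerDr !innerZl !innerZr (innerC w).
  move: H; move: (inner (S *m g) _) (inner _ w) (inner w w) => a b e H sq.
  have : 0 <= kappa^-1 / 2 * (kappa * (kappa * a) + kappa * b + (kappa * b + e)).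
    by apply: mulr_ge0; [rewrite divr_ge0 // invr_ge0 ltW | lra].
  have -> : kappa^-1 / 2 * (kappa * (kappa * a) + kappa * b + (kappa * b + e)) =
    kappa / 2 * a + b + kappa^-1 * e / 2 by field; rewrite gt_eqF.
  by lra.
have : kappa^-1 * (f x - f xstar) <= inner (S *m g) (S *m g) / 2.
  by rewrite mulrC ler_pdivrMr //; lra.
by lra.
Qed.

(** * Means, regret and the choice of stepsize *)

Lemma prod_le_mean_exp (R : realFieldType) K (r : nat -> R) :
  (forall k, (k < K)%N -> 0 <= r k) ->
  \prod_(k < K) r k <= ((\sum_(k < K) r k) / K%:R) ^+ K.
Proof.
move=> r0.
have [+ _] := leif_AGM (A := predT) (fun (i : 'I_K) _ => r0 i (ltn_ord i)).
by rewrite (_ : #|_| = K) // -[RHS]card_ord; apply: eq_card.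
Qed.

(** Comparing the two quadratic bounds at distinct points gives [mu <= L]; the strict inequality of
    values only makes the points distinct. *)
Lemma smooth_modulus_gt0 (R : realType) n (f : 'cV[R]_n -> R) L mu x y :
  0 < mu -> smooth L f -> strongly_convex mu f -> f y < f x -> 0 < L.
Proof.
move=> mu0 fL fmu fyx; have := le_trans (fmu x y) (ler_normlW (fL x y)).
rewrite ler_pM2r => [|]; first by lra.
rewrite fnorm_sqr lt_neqAle inner_ge0 andbT eq_sym inner_eq0 subr_eq0.
by apply: contraTneq fyx => ->; rewrite ltxx.
Qed.

Lemma regret_telescope (R : realFieldType) (d r : nat -> R) (eta c rho : R) K :
  (forall k, (k < K)%N -> d k.+1 <= d k - 2 * eta * (r k - rho) + c * r k) ->
  (2 * eta - c) * \sum_(k < K) r k <= d 0%N - d K + 2 * eta * rho * K%:R.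
Proof.
elim: K => [_|K IH step]; first by rewrite big_ord0; lra.
have := IH (fun k kK => step k (ltnW kK)); have := step K (ltnSn K).
by rewrite big_ord_recr /= -natr1; lra.
Qed.

(** Dividing the regret bound by [2 * eta * K%:R] gives [(1 - a / 2) * A <= E + rho], where [a] is
    the cost of the gradient norms and [E] that of the initial distance. The cap on [eta] gives
    [a <= 1], which allows solving for the mean [A]. *)
Lemma mean_ratio_bound (R : realType) (L D eta rho S : R) K :
  0 < L -> 0 < D -> (0 < K)%N -> rho <= 1 -> 0 <= S ->
  eta = Num.min (1 / (4 * L ^+ 2)) (D / (2 * L * Num.sqrt K%:R)) ->
  (2 * eta - 4 * L ^+ 2 * eta ^+ 2) * S <= D ^+ 2 + 2 * eta * rho * K%:R ->
  S / K%:R <= rho + Num.max (4 * L * D / Num.sqrt K%:R)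
                            (8 * L ^+ 2 * D ^+ 2 / K%:R).
Proof.
move=> L0 D0 K0 rho1 S0 etaE regret.
have k0 : 0 < K%:R :> R by rewrite ltr0n.
set s := Num.sqrt K%:R in etaE *.
have s0 : 0 < s by rewrite sqrtr_gt0.
have sE : K%:R = s ^+ 2 by rewrite sqr_sqrtr // ltW.
have p0 : 0 < 1 / (4 * L ^+ 2) by rewrite divr_gt0 // mulr_gt0 // exprn_gt0.
have q0 : 0 < D / (2 * L * s) by rewrite divr_gt0 // !mulr_gt0.
have eta0 : 0 < eta by rewrite etaE lt_min p0.
set a := 4 * L ^+ 2 * eta; set E := D ^+ 2 / (2 * eta * K%:R).
set A := S / K%:R.
have a0 : 0 <= a by rewrite !mulr_ge0 // ?sqr_ge0 // ltW.
have a1 : a <= 1.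
  have : eta <= 1 / (4 * L ^+ 2) by rewrite etaE ge_min lexx.
  by rewrite ler_pdivlMr ?mulr_gt0 ?exprn_gt0 // mulrC.
have E0 : 0 <= E by rewrite divr_ge0 ?sqr_ge0 // !mulr_ge0 // ltW.
have A0 : 0 <= A by rewrite divr_ge0 // ltW.
have mean : (1 - a / 2) * A <= E + rho.
  rewrite -(ler_pM2l (x := 2 * eta * K%:R)) ?mulr_gt0 //.
  have -> : 2 * eta * K%:R * ((1 - a / 2) * A) =
      (2 * eta - 4 * L ^+ 2 * eta ^+ 2) * S.
    by rewrite /a /A; field; rewrite gt_eqF.
  have -> // : 2 * eta * K%:R * (E + rho) = D ^+ 2 + 2 * eta * rho * K%:R.
  by rewrite /E; field; rewrite !gt_eqF.
(* [(1 + a) (1 - a / 2) = 1 + a (1 - a) / 2 >= 1] *)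
have bound : A <= rho + (a + 2 * E).
  have : (1 + a) * ((1 - a / 2) * A) <= (1 + a) * (E + rho).
    by apply: ler_wpM2l => //; lra.
  have : 0 <= a * (1 - a) * A by rewrite !mulr_ge0 //; lra.
  have : 0 <= (1 - a) * E by rewrite mulr_ge0 //; lra.
  have : 0 <= a * (1 - rho) by rewrite mulr_ge0 //; lra.
  by lra.
apply: le_trans bound _; rewrite lerD2l le_max; apply/orP.
(* Write [t = 2 * L * D / s]. If the first stepsize is the smaller, then [a = 1], [E = t ^+ 2 / 2]
   and [1 <= t], so [a + 2 * E <= 2 * t ^+ 2]. Otherwise [a = t] and [E = t / 2], so
   [a + 2 * E = 2 * t]. *)
have [pq|qp] := leP (1 / (4 * L ^+ 2)) (D / (2 * L * s)).
  right; have etap : eta = 1 / (4 * L ^+ 2) by rewrite etaE min_l.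
  have -> : a = 1 by rewrite /a etap; field; rewrite gt_eqF.
  have -> : E = 2 * L ^+ 2 * D ^+ 2 / K%:R.
    by rewrite /E etap; field; rewrite !gt_eqF.
  move: pq; have -> : D / (2 * L * s) = 2 * L * D / s / (4 * L ^+ 2).
    by field; rewrite !gt_eqF.
  rewrite ler_pM2r ?invr_gt0 ?mulr_gt0 ?exprn_gt0 // => pq.
  have -> : 8 * L ^+ 2 * D ^+ 2 / K%:R = 2 * (2 * L * D / s) ^+ 2.
    by rewrite sE; field; rewrite gt_eqF.
  have -> : 2 * L ^+ 2 * D ^+ 2 / K%:R = (2 * L * D / s) ^+ 2 / 2.
    by rewrite sE; field; rewrite gt_eqF.
  have : 1 <= (2 * L * D / s) ^+ 2 by rewrite exprn_ege1.
  by lra.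
left; have etaq : eta = D / (2 * L * s) by rewrite etaE min_r // ltW.
have -> : a = 2 * L * D / s by rewrite /a etaq; field; rewrite !gt_eqF.
have -> : E = L * D / s by rewrite /E etaq sE; field; rewrite !gt_eqF.
by rewrite -!mulrA; lra.
Qed.

(** * One projected gradient step and the final rate *)

Section OnlineGradient.
Variables (R : realType) (n : nat) (f : 'cV[R]_n -> R) (L mu : R).
Variables (xstar : 'cV[R]_n) (C : set 'M[R]_n).
Hypotheses (df : forall z, differentiable f z) (fL : smooth L f) (L0 : 0 < L).
Hypotheses (mu0 : 0 < mu) (fmu : strongly_convex mu f).
Hypotheses (fmin : minimizer f xstar) (cC : convex_set C).

(** After the projection is removed by contraction, convexity controls the cross term of the
    expanded square and the self-bounding gradient controls its [eta ^+ 2] term. *)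
Lemma osgm_step_regret eta x P P' Q : 0 <= eta -> f xstar < f x -> C Q ->
  is_projection C (P - eta *: grad (ratio_surrogate f xstar x) P) P' ->
  inner (P' - Q) (P' - Q) <= inner (P - Q) (P - Q)
    - 2 * eta * (ratio_surrogate f xstar x P - ratio_surrogate f xstar x Q)
    + 4 * L ^+ 2 * eta ^+ 2 * ratio_surrogate f xstar x P.
Proof.
move=> eta0 fx CQ /(projection_contracts cC)/(_ CQ)/le_trans; apply.
have := ratio_surrogate_convex df P Q mu0 fmu fx.
have := ratio_surrogate_grad_bound df P L0 fL fmin fx.
move: (ratio_surrogate _ _ _ P) (ratio_surrogate _ _ _ Q) => r s.
move: (grad _ P) => g hg.
rewrite -(opprB P Q) innerNr addrAC.
move: (P - Q) => D; rewrite innerDl !innerDr !innerNl !innerNr !innerZl !innerZr.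
rewrite (innerC D g) => hs.
have : 0 <= eta * (s - r + inner g D) by rewrite mulr_ge0 //; lra.
have : 0 <= eta ^+ 2 * (4 * L ^+ 2 * r - inner g g).
  by rewrite mulr_ge0 ?sqr_ge0 // subr_ge0.
by lra.
Qed.

End OnlineGradient.

Theorem theorem4p2 (R : realType) (n : nat) (f : 'cV[R]_n -> R) (L mu : R)
    (xstar : 'cV[R]_n) (Pset : set 'M[R]_n) (Pstar : 'M[R]_n) (kappa : R)
    (K : nat) (x : nat -> 'cV[R]_n) (P : nat -> 'M[R]_n) :
  twice_differentiable f ->
  smooth L f ->
  0 < mu ->
  strongly_convex mu f ->
  minimizer f xstar ->
  closed Pset ->
  convex_set Pset ->
  universal_optimal_precond f Pset Pstar kappa ->
  (1 <= K)%N ->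
  Pset (P 1%N) ->
  osgm_r f xstar Pset
    (Num.min (1 / (4 * L ^+ 2))
             (fnorm (Pstar - P 1%N) / (2 * L * Num.sqrt K%:R))) K x P ->
  (forall k : nat, (1 <= k <= K)%N -> ~ minimizer f (x k)) ->
  f (x K.+1) - f xstar <=
    (f (x 1%N) - f xstar) *
    (1 - 1 / kappa +
     Num.max (4 * L * fnorm (Pstar - P 1%N) / Num.sqrt K%:R)
             (8 * L ^+ 2 * fnorm (Pstar - P 1%N) ^+ 2 / K%:R)) ^+ K.
Proof.
move=> f2 fL mu0 fmu fmin _ cP [Pfeas _] K0 _ osgm xmin.
have [df _] := f2; have [kappa0 CPstar _ _] := Pfeas.
have gap k : (k < K)%N -> f xstar < f (x k.+1).
  move=> kK; rewrite ltNge; apply/negP => le; apply: (xmin k.+1) => // y.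
  exact: le_trans le (fmin y).
have L0 := smooth_modulus_gt0 mu0 fL fmu (gap 0%N K0).
set D := fnorm _ in osgm *; set eta := Num.min _ _ in osgm.
set rho := 1 - 1 / kappa.
(* Indices are shifted so that sums and products over [k < K] cover the iterates 1 to [K]. *)
pose r k := ratio_surrogate f xstar (x k.+1) (P k.+1).
pose d k := inner (P k.+1 - Pstar) (P k.+1 - Pstar).
have D0 : 0 <= D := fnorm_ge0 _.
have dD : d 0%N = D ^+ 2.
  by rewrite /d /D fnorm_sqr -opprB innerNl innerNr opprK.
have rho1 : rho <= 1 by rewrite gerBl divr_ge0 // ltW.
have eta0 : 0 <= eta.
  rewrite le_min !divr_ge0 ?mulr_ge0 ?sqr_ge0 ?sqrtr_ge0 //; exact: ltW.
have r0 k : (k < K)%N -> 0 <= r k.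
  by move=> kK; rewrite divr_ge0 // subr_ge0 // ltW // gap.
have rstar k : (k < K)%N -> ratio_surrogate f xstar (x k.+1) Pstar <= rho.
  move=> kK; rewrite /ratio_surrogate ler_pdivrMr ?subr_gt0 ?gap //.
  by rewrite /rho div1r; exact: preconditioned_step f2 Pfeas.
have step k : (k < K)%N ->
    d k.+1 <= d k - 2 * eta * (r k - ratio_surrogate f xstar (x k.+1) Pstar)
      + 4 * L ^+ 2 * eta ^+ 2 * r k.
  move=> kK; have [_ proj] := osgm k.+1 kK.
  by apply: (osgm_step_regret df fL L0 mu0 fmu fmin cP) => //; exact: gap.
have descent m : (m <= K)%N ->
    f (x m.+1) - f xstar = (f (x 1%N) - f xstar) * \prod_(k < m) r k.
  elim: m => [|m IH] mK; first by rewrite big_ord0 mulr1.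
  rewrite big_ord_recr /= mulrA -IH ?(ltnW mK) // /r /ratio_surrogate.
  have [-> _] := osgm m.+1 mK.
  by rewrite mulrC divfK // subr_eq0 gt_eqF // gap.
have S0 : 0 <= \sum_(k < K) r k by apply: sumr_ge0 => k _; exact: r0.
rewrite descent // ler_pM2l ?subr_gt0 ?gap //.
apply: le_trans (prod_le_mean_exp r0) _.
have mean_ge0 : 0 <= (\sum_(k < K) r k) / K%:R by rewrite divr_ge0.
set M := Num.max _ _.
(* The base [rho + M] is nonnegative because it dominates a nonnegative mean, so powers preserve the
   inequality. *)
suff mean_le : (\sum_(k < K) r k) / K%:R <= rho + M.
  by apply: lerXn2r; rewrite ?nnegrE ?(le_trans mean_ge0 mean_le).
rewrite {}/M.
(* When [P 1] is already [Pstar] the stepsize is 0 and the regret bound cannot be divided by it;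
   instead the iterates [P k] stay at [Pstar], and each ratio is at most [rho]. *)
move: D0; rewrite le_eqVlt => /predU1P[D0|D0].
  have etaz : eta = 0.
    by rewrite /eta -D0 mul0r min_r // divr_ge0 // mulr_ge0 // sqr_ge0.
  have dz k : (k <= K)%N -> d k = 0.
    elim: k => [|k IH] kK; first by rewrite dD -D0 expr0n.
    apply/le_anti; rewrite inner_ge0 andbT.
    by have := step k kK; rewrite etaz IH ?(ltnW kK) //; lra.
  rewrite -D0 expr0n /= !mulr0 !mul0r maxxx addr0 ler_pdivrMr ?ltr0n //.
  rewrite mulr_natr -[X in _ *+ X]card_ord -sumr_const.
  apply: ler_sum => k _; rewrite /r.
  have /eqP := dz k (ltnW (ltn_ord k)).
  rewrite inner_eq0 subr_eq0 => /eqP->; exact: rstar.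
apply: (mean_ratio_bound (eta := eta)) => //.
have := regret_telescope (d := d) (r := r) (eta := eta)
  (c := 4 * L ^+ 2 * eta ^+ 2) (rho := rho) (K := K).
have : 0 <= d K := inner_ge0 _.
rewrite dD => dK /(_ _)/le_trans-> //; last by lra.
move=> k kK; apply: le_trans (step k kK) _.
rewrite lerD2r lerD2l lerN2 ler_wpM2l ?mulr_ge0 // lerD2l lerN2.
exact: rstar.
Qed.
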